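(* Let $p,q,r>1$, $k\in[0,1)$ and $x\in[0,K_{p,q,r}(k)]$. Then the following hold. (i) If $p\ge2$, then $$\left(\operatorname{sn}_{p,q,r}^{q/p}(x,k)+\operatorname{cn}_{p,q,r}(x,k)\right)^{p^*}\le1+2^{2/p}\operatorname{sn}_{p,q,r}^{q/p}(x,k)\operatorname{cn}_{p,q,r}(x,k).$$ This inequality is reversed if $p\in(1,2]$. (ii) If $q\ge2$, then $$\left(\operatorname{sn}_{p,q,r}(x,k)+\operatorname{cn}_{p,q,r}^{p/q}(x,k)\right)^{q^*}\le1+2^{2/q}\operatorname{sn}_{p,q,r}(x,k)\operatorname{cn}_{p,q,r}^{p/q}(x,k).$$ This inequality is reversed if $q\in(1,2]$.
   Context: For $s>1$, $s^*:=s/(s-1)$. For $p,q,r>1$ and $k\in[0,1)$ let $H_{p,q,r}(x,k):=\int_0^x\frac{dt}{(1-t^q)^{1/p}(1-k^qt^q)^{1-1/r}}$ for $x\in[0,1]$, and $K_{p,q,r}(k):=H_{p,q,r}(1,k)<\infty$. $H_{p,q,r}(\cdot,k)$ is an increasing bijection $[0,1]\to[0,K_{p,q,r}(k)]$; its inverse is $\operatorname{sn}_{p,q,r}(\cdot,k):[0,K_{p,q,r}(k)]\to[0,1]$, and $\operatorname{cn}_{p,q,r}(x,k):=(1-\operatorname{sn}_{p,q,r}^q(x,k))^{1/p}$. A superscript on $\operatorname{sn},\operatorname{cn}$ denotes a power. *)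

(* Defs.v *)
From HB Require Import structures.
From mathcomp Require Import all_boot all_order all_algebra.
From mathcomp Require Import all_classical all_reals all_analysis.

Set Implicit Arguments.
Unset Strict Implicit.
Unset Printing Implicit Defensive.

Import Order.TTheory GRing.Theory Num.Theory.
Import numFieldNormedType.Exports.

Local Open Scope classical_set_scope.
Local Open Scope ring_scope.

Definition conj_exp (R : realType) (s : R) : R := s / (s - 1).

(* For x = 1 the integral is improper at t = 1.  The integrand is
   nonnegative, so the Lebesgue integral over [0, 1] is the improper integral;
   the value 0^-1 = 0 taken by the integrand at t = 1 is irrelevant. *)
Definition Hpqr (R : realType) (p q r x k : R) : R :=
  \int[lebesgue_measure]_(t in `[0, x])
    ((1 - t `^ q) `^ p^-1 * (1 - k `^ q * t `^ q) `^ (1 - r^-1))^-1.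

Definition Kpqr (R : realType) (p q r k : R) : R := Hpqr p q r 1 k.

(* The inverse of H(., k) : [0, 1] -> [0, K(k)]; 0 outside the image. *)
Definition sn (R : realType) (p q r x k : R) : R :=
  'pinv_(fun=> 0) `[0, 1] (fun y => Hpqr p q r y k) x.

Definition cn (R : realType) (p q r x k : R) : R :=
  (1 - sn p q r x k `^ q) `^ p^-1.

(* Main.v *)
Require Import Defs.
From HB Require Import structures.
From mathcomp Require Import all_boot all_order all_algebra.
From mathcomp Require Import all_classical all_reals all_analysis.
From mathcomp Require Import ring lra.

(** Write [S = sn p q r x k], which lies in [[0, 1]].  Both parts are the same
    inequality, for the exponents [s = p] and [s = q]: if [a, b >= 0] and
    [a ^ s + b ^ s = 1] then [(a + b) ^ s* <= 1 + 2 ^ (2 / s) a b] for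
    [s >= 2], reversed for [s <= 2].

    Put [c = 1 / s], [L = ln cosh], and parametrize [a ^ s] and [b ^ s] by
    [exp (+- z) / (2 cosh z)] with [z >= 0].  Taking logarithms, the claim is
    [D z := c ^ 2 L z + (1 - c) L (c L z) - L (c z) >= 0] for [c <= 1/2]
    (and [<= 0] for [c >= 1/2]).  Here [D 0 = 0] and [D] vanishes at infinity,
    so it suffices that [D'] is first [>= 0], then [<= 0].  For both signs of
    [1 - 2 c] at once, everything is multiplied by a constant [sg] with
    [sg (1 - 2 c) >= 0].

    The sign of [D'] is that of [M = (cosh z) ^ (2 c) sinh ((1 - c) z) - N]
    with [N = (1 - c) sinh ((1 + c) z) - c sinh ((1 - c) z) > 0], and [M / N]
    tends to [0] at [0].  Up to a positive factor, [(M / N)'] is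
    [(1 - c) ^ 2 sinh ((1 + 2 c) z) - c ^ 2 sinh ((3 - 2 c) z)
     - 2 c (1 - 2 c) sinh z - (1 - 2 c ^ 2) sinh ((1 - 2 c) z)].
    The sign pattern [+, -] passes from a derivative to a primitive that is
    [>= 0] at [0], hence also from [F'' - b ^ 2 F] to [F]; applying this with
    [b = 1] and [b = 1 + 2 c] leaves two terms of constant sign. *)

Set Implicit Arguments.
Unset Strict Implicit.
Unset Printing Implicit Defensive.

Import Order.TTheory GRing.Theory Num.Theory.
Import numFieldNormedType.Exports.

Local Open Scope classical_set_scope.
Local Open Scope ring_scope.

(** * Differentiation rules, and monotonicity from the sign of a derivative *)

Section Derivatives.
Context {R : realType}.
Implicit Types (f g : R -> R) (x a b d e : R).

Lemma is_deriveD_fun f g x d e : is_derive x (1 : R) f d -> is_derive x (1 : R) g e ->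
  is_derive x (1 : R) (fun z => f z + g z) (d + e).
Proof. exact: is_deriveD. Qed.

Lemma is_deriveN_fun f x d : is_derive x (1 : R) f d ->
  is_derive x (1 : R) (fun z => - f z) (- d).
Proof. exact: is_deriveN. Qed.

Lemma is_deriveM_fun f g x d e : is_derive x (1 : R) f d -> is_derive x (1 : R) g e ->
  is_derive x (1 : R) (fun z => f z * g z) (f x * e + g x * d).
Proof. exact: is_deriveM. Qed.

Lemma is_deriveZ_fun a f x d : is_derive x (1 : R) f d ->
  is_derive x (1 : R) (fun z => a * f z) (a * d).
Proof. exact: (is_deriveZ a). Qed.

Lemma is_derive_scale a f x d : is_derive (a * x) (1 : R) f d ->
  is_derive x (1 : R) (fun z => f (a * z)) (a * d).
Proof.
move=> fd; rewrite mulrC; apply: (is_derive1_comp (f := f) (g := fun z => a * z)) => //.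
by rewrite -[X in is_derive _ _ _ X]mulr1; apply: is_deriveZ_fun; exact: is_derive_id.
Qed.

Lemma is_derive_expR_fun f x d : is_derive x (1 : R) f d ->
  is_derive x (1 : R) (fun z => expR (f z)) (expR (f x) * d).
Proof. by move=> fd; apply: (is_derive1_comp (f := expR) (g := f)). Qed.

Lemma is_derive_continuous f x d : is_derive x (1 : R) f d -> {for x, continuous f}.
Proof. by move=> [fd _]; apply/differentiable_continuous/derivable1_diffP. Qed.

Lemma is_derive_mvt f df a b : a < b ->
  (forall x, a <= x <= b -> is_derive x (1 : R) f (df x)) ->
  exists2 c, a < c < b & f b - f a = df c * (b - a).
Proof.
move=> ab fd; have [c xab||c cab e] := @MVT R f df a b ab.
- by apply: fd; move: xab; rewrite in_itv/= => /andP[/ltW -> /ltW ->].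
- by apply: derivable_within_continuous => c; rewrite in_itv/= => /fd [].
- by exists c => //; move: cab; rewrite in_itv.
Qed.

Lemma is_derive_ge0_le f df a b : a <= b ->
  (forall x, a <= x <= b -> is_derive x (1 : R) f (df x)) ->
  (forall x, a < x < b -> 0 <= df x) -> f a <= f b.
Proof.
rewrite le_eqVlt => /predU1P[->//|ab] fd d0.
have [c cab e] := is_derive_mvt ab fd.
by rewrite -subr_ge0 e mulr_ge0 ?subr_ge0 ?d0// ltW.
Qed.

Lemma is_derive_gt0_lt f df a b : a < b ->
  (forall x, a <= x <= b -> is_derive x (1 : R) f (df x)) ->
  (forall x, a < x < b -> 0 < df x) -> f a < f b.
Proof.
move=> ab fd d0; have [c cab e] := is_derive_mvt ab fd.
by rewrite -subr_gt0 e mulr_gt0 ?subr_gt0 ?d0.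
Qed.

(** The Carathéodory slope of [f] at [x] is continuous with value [d > 0] there, hence positive
    nearby. *)
Lemma is_derive_pos_near f x d : is_derive x (1 : R) f d -> 0 < d ->
  forall e, 0 < e -> exists y, x < y <= x + e /\ f x < f y.
Proof.
move=> /is_derive1_caratheodory [g [fE gc gx]] d0 e e0.
have : \forall y \near x, 0 < g y by apply: (cvgr_gt (g x) gc); rewrite gx.
move=> /nbhs_ballP [r /= r0 rg].
pose t := Num.min (r / 2) e.
have t0 : 0 < t by rewrite /t lt_min e0 divr_gt0.
exists (x + t); split; first by rewrite ltrDl t0 lerD2l /t ge_min lexx orbT.
rewrite -subr_gt0 fE (_ : x + t - x = t); last by ring.
rewrite mulr_gt0//.
apply: rg; rewrite /ball/= (_ : x - (x + t) = - t); last by ring.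
rewrite normrN gtr0_norm//.
by rewrite /t gt_min; apply/orP; left; lra.
Qed.

End Derivatives.

(** * The range of [sn] *)

(** The pseudo-inverse returns either a preimage chosen in [A] or the default value. For [sn] the
    default is [0], so [sn] takes its values in [[0, 1]] by construction. *)
Lemma pinv_dflt_mem (aT rT : Type) (dflt : rT -> aT) (A : set aT) (f : aT -> rT) y :
  A (dflt y) -> A ('pinv_dflt A f y).
Proof.
move=> Ad; rewrite /pinv_ splitV.
suff : 'oinv_[fun f in A] y = None \/ exists2 a, A a & 'oinv_[fun f in A] y = Some a.
  by case=> [|[a Aa]] ->.
have [/(oinvP [fun f in A])[a Aa _]|fAy] := pselect ((f @` A) y).
  by right; exists a.
left; change ('oinv_((fun _ => id) : set_surj A (f @` A) f) y = None).
by rewrite oinv_surj; case: pselect.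
Qed.

Lemma sn_itv01 (R : realType) (p q r x k : R) : 0 <= sn p q r x k <= 1.
Proof.
have := @pinv_dflt_mem R R (fun=> 0) `[0, 1] (fun y => Hpqr p q r y k) x.
by rewrite /= in_itv/= in_itv/= lexx ler01; apply.
Qed.

(** * Functions that are first nonnegative, then nonpositive *)

Section SignChange.
Context {R : realType}.
Implicit Types (f g F N h : R -> R) (x y z a b d e : R).

(** Stated at every [z] rather than with a point of sign change, so that functions of constant sign
    are included and no such point has to be located. *)
Definition pos_then_neg f := forall z, 0 < z ->
  (forall y, 0 < y <= z -> 0 <= f y) \/ (forall y, z <= y -> f y <= 0).

Lemma pos_then_neg_eq_sign f g :
  (forall x, 0 < x -> (0 <= f x -> 0 <= g x) /\ (f x <= 0 -> g x <= 0)) ->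
  pos_then_neg f -> pos_then_neg g.
Proof.
move=> fg sf z z0; have [fp|fn] := sf z z0; [left|right] => y.
- by move=> /andP[y0 yz]; apply: (fg y y0).1; apply: fp; rewrite y0.
- by move=> zy; apply: (fg y (lt_le_trans z0 zy)).2; apply: fn.
Qed.

Lemma pos_then_neg_mul f h : (forall x, 0 < x -> 0 <= h x) ->
  pos_then_neg f -> pos_then_neg (fun x => h x * f x).
Proof.
move=> h0; apply: pos_then_neg_eq_sign => x /h0 hx.
by split=> fx; [exact: mulr_ge0|exact: mulr_ge0_le0].
Qed.

Lemma pos_then_neg_le0 f : (forall x, 0 < x -> f x <= 0) -> pos_then_neg f.
Proof. by move=> f0 z z0; right => y /(lt_le_trans z0)/f0. Qed.

(* Where [f >= 0], [F] increases from a nonnegative limit at [0]; once [f <= 0], [F] decreases, so it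
   cannot become positive again. *)
Lemma pos_then_neg_primitive F f : (forall x, 0 < x -> is_derive x (1 : R) F (f x)) ->
  (forall e z, 0 < e -> 0 < z -> exists2 y, 0 < y <= z & - e <= F y) ->
  pos_then_neg f -> pos_then_neg F.
Proof.
move=> Ff F0 sf z z0.
have incr y : 0 < y -> (forall x, 0 < x <= y -> 0 <= f x) -> 0 <= F y.
  move=> y0 fy; rewrite leNgt; apply/negP => Fy.
  have [|x /andP[x0 xy] Fx] := F0 (- F y / 2) y _ y0; first by lra.
  suff : F x <= F y by lra.
  apply: (is_derive_ge0_le (df := f)) => // w /andP[xw wy].
    by apply: Ff; exact: lt_le_trans xw.
  by apply: fy; rewrite (ltW wy) (lt_trans x0).
have decr y1 y2 : 0 < y1 <= y2 -> (forall x, y1 <= x -> f x <= 0) -> F y2 <= F y1.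
  move=> /andP[y10 y12] fy; rewrite -lerN2.
  apply: (is_derive_ge0_le (f := fun x => - F x) (df := fun x => - f x)) => // w /andP[xw wy].
    by apply: is_deriveN_fun; apply: Ff; exact: lt_le_trans xw.
  by rewrite oppr_ge0 fy// ltW.
have [fp|fn] := sf z z0.
  left=> y /andP[y0 yz]; apply: incr => // x /andP[x0 xy].
  by apply: fp; rewrite x0 (le_trans xy).
have [Fz|Fz] := leP (F z) 0.
  by right => y zy; apply: le_trans Fz; apply: decr => //; rewrite z0.
left=> y /andP[y0 yz].
have [fp|fn'] := sf y y0; first exact: incr.
by apply: (le_trans (ltW Fz)); apply: decr => //; rewrite y0.
Qed.

(** Continuity at [0] turns [0 <= F 0] into the lower bounds [- e] near [0]. *)
Lemma pos_then_neg_primitive0 F f : (forall x, is_derive x (1 : R) F (f x)) ->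
  0 <= F 0 -> pos_then_neg f -> pos_then_neg F.
Proof.
move=> Ff F0; apply: pos_then_neg_primitive => // e z e0 z0.
have : \forall y \near 0, - e < F y.
  by apply: (cvgr_gt (F 0) (is_derive_continuous (Ff 0))); lra.
move=> /nbhs_ballP [r /= r0 rF]; exists (Num.min (r / 2) z).
  by rewrite lt_min z0 ge_min lexx orbT andbT divr_gt0.
apply/ltW/rF; rewrite /ball/= sub0r normrN gtr0_norm ?lt_min ?z0 ?divr_gt0//.
by rewrite gt_min; apply/orP; left; lra.
Qed.

(* Factor [d^2 - b^2] as [(d + b)(d - b)] and use the integrating factors
   [exp (b x)] and [exp (- b x)]. *)
Lemma pos_then_neg_order2 b F f g : (forall x, is_derive x (1 : R) F (f x)) ->
  (forall x, is_derive x (1 : R) f (g x)) -> 0 <= F 0 -> b * F 0 <= f 0 ->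
  pos_then_neg (fun x => g x - b ^+ 2 * F x) -> pos_then_neg F.
Proof.
move=> Ff fg F0 f0 sg.
have exp' a x : is_derive x (1 : R) (fun x => expR (a * x)) (a * expR (a * x)).
  by apply: is_derive_scale; exact: is_derive_expR.
have unexp a h : pos_then_neg (fun x => expR (a * x) * h x) -> pos_then_neg h.
  apply: pos_then_neg_eq_sign => x _.
  by rewrite pmulr_rge0 ?expR_gt0// pmulr_rle0 ?expR_gt0.
suff G : pos_then_neg (fun x => f x - b * F x).
  apply: (unexp (- b)).
  apply: (pos_then_neg_primitive0
    (f := fun x => expR (- b * x) * (f x - b * F x))).
  - move=> x; apply: (is_derive_eq (is_deriveM_fun (exp' (- b) x) (Ff x))).
    ring.
  - by rewrite mulr0 expR0 mul1r.
  - by apply: pos_then_neg_mul => // x _; exact: expR_ge0.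
apply: (unexp b).
apply: (pos_then_neg_primitive0 (f := fun x => expR (b * x) * (g x - b ^+ 2 * F x))).
- move=> x; have Gx := is_deriveD_fun (fg x) (is_deriveN_fun (is_deriveZ_fun b (Ff x))).
  apply: (is_derive_eq (is_deriveM_fun (exp' b x) Gx)); ring.
- by rewrite mulr0 expR0 mul1r subr_ge0.
- by apply: pos_then_neg_mul => // x _; exact: expR_ge0.
Qed.

(** The function [f + e N] vanishes at [0] with slope [e d > 0], so it is positive at points
    arbitrarily close to [0]. This handles the indeterminate form [M / N] at [0]. *)
Lemma quotient_ge_near0 f N d e z : is_derive (0 : R) (1 : R) f 0 ->
  is_derive (0 : R) (1 : R) N d -> f 0 = 0 -> N 0 = 0 -> 0 < d ->
  (forall x, 0 < x -> 0 < N x) -> 0 < e -> 0 < z ->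
  exists2 y, 0 < y <= z & - e <= f y / N y.
Proof.
move=> f0' N0' f0 N0 d0 Np e0 z0.
have FN : is_derive (0 : R) (1 : R) (fun x => f x + e * N x) (0 + e * d).
  by apply: is_deriveD_fun => //; exact: is_deriveZ_fun.
have [|y [/andP[y0 yz]]] := is_derive_pos_near FN _ z0.
  by rewrite add0r mulr_gt0.
rewrite f0 N0 mulr0 addr0 => fN; exists y; first by rewrite y0 -[z]add0r.
by rewrite ler_pdivlMr ?Np//; lra.
Qed.

(** Either [F] increases on [[0, x]], or it decreases from [x] on; in the latter case [F x < 0]
    would keep [F] away from [0] at infinity. *)
Lemma pos_then_neg_ge0 F f : (forall x, is_derive x (1 : R) F (f x)) -> F 0 = 0 ->
  pos_then_neg f -> (forall e z, 0 < e -> 0 < z -> exists2 y, z <= y & - e <= F y) ->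
  forall x, 0 <= x -> 0 <= F x.
Proof.
move=> Ff F0 sf Foo x; rewrite le_eqVlt => /predU1P[<-|x0]; first by rewrite F0.
have [fp|fn] := sf x x0.
  rewrite -F0; apply: (is_derive_ge0_le (df := f)); first exact: ltW.
  move=> w /andP[w0 wx].
  by apply: fp; rewrite w0 ltW.
rewrite leNgt; apply/negP => Fx.
have [|y xy Fy] := Foo (- F x / 2) x _ x0; first by lra.
suff : - F x <= - F y by lra.
apply: (is_derive_ge0_le (f := fun x => - F x) (df := fun x => - f x)) => // w /andP[xw wy].
by rewrite oppr_ge0 fn// ltW.
Qed.

End SignChange.

(** * Hyperbolic functions and sign changes of sums of [sinh] *)

Section Hyperbolic.
Context {R : realType}.
Implicit Types (x y z a b c sg : R) (s : seq (R * R)).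

Definition sinh x : R := (expR x - expR (- x)) / 2.
Definition cosh x : R := (expR x + expR (- x)) / 2.

Lemma sinh0 : sinh 0 = 0.
Proof. by rewrite /sinh oppr0 subrr mul0r. Qed.

Lemma cosh0 : cosh 0 = 1.
Proof. by rewrite /cosh oppr0 expR0; lra. Qed.

Lemma sinhN x : sinh (- x) = - sinh x.
Proof. by rewrite /sinh opprK; ring. Qed.

Lemma coshN x : cosh (- x) = cosh x.
Proof. by rewrite /cosh opprK addrC. Qed.

Lemma sinhD x y : sinh (x + y) = sinh x * cosh y + cosh x * sinh y.
Proof.
rewrite /sinh /cosh opprD !expRD !expRN.
have X0 : expR x != 0 by rewrite gt_eqF ?expR_gt0.
have Y0 : expR y != 0 by rewrite gt_eqF ?expR_gt0.
by field; rewrite X0 Y0.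
Qed.

Lemma cosh_gt0 x : 0 < cosh x.
Proof. by rewrite divr_gt0// addr_gt0// expR_gt0. Qed.

Lemma ler_sinh x y : x <= y -> sinh x <= sinh y.
Proof.
move=> xy; rewrite ler_pM2r ?invr_gt0//.
by rewrite lerD// ?lerN2 ler_expR// lerN2.
Qed.

Lemma sinh_ge0 x : 0 <= x -> 0 <= sinh x.
Proof. by move=> x0; rewrite -sinh0; exact: ler_sinh. Qed.

Lemma is_derive_sinh x : is_derive x (1 : R) sinh (cosh x).
Proof.
have e := is_derive_expR_fun (is_deriveN_fun (is_derive_id x (1 : R))).
have := is_deriveZ_fun 2^-1 (is_deriveD_fun (is_derive_expR x) (is_deriveN_fun e)).
rewrite (_ : (fun z => _) = sinh); last by apply/funext => z; rewrite mulrC.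
by move/is_derive_eq; apply; rewrite /cosh /=; field.
Qed.

Lemma is_derive_cosh x : is_derive x (1 : R) cosh (sinh x).
Proof.
have e := is_derive_expR_fun (is_deriveN_fun (is_derive_id x (1 : R))).
have := is_deriveZ_fun 2^-1 (is_deriveD_fun (is_derive_expR x) e).
rewrite (_ : (fun z => _) = cosh); last by apply/funext => z; rewrite mulrC.
by move/is_derive_eq; apply; rewrite /sinh /=; field.
Qed.

Lemma ler_cosh x y : 0 <= x <= y -> cosh x <= cosh y.
Proof.
move=> /andP[x0 xy]; apply: (is_derive_ge0_le (df := sinh)) => // [z _|z /andP[xz _]].
  exact: is_derive_cosh.
by rewrite sinh_ge0// (le_trans x0)// ltW.
Qed.

(** Pairs are (coefficient, frequency), so that differentiation acts on the list alone. *)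
Definition sinh_sum s z : R := \sum_(i <- s) i.1 * sinh (i.2 * z).
Definition cosh_sum s z : R := \sum_(i <- s) i.1 * cosh (i.2 * z).

Lemma is_derive_sinh_sum s z :
  is_derive z (1 : R) (sinh_sum s) (cosh_sum [seq (i.1 * i.2, i.2) | i <- s] z).
Proof.
elim: s => [|i s IH].
  rewrite /cosh_sum big_nil (_ : sinh_sum _ = cst 0); first exact: is_derive_cst.
  by apply/funext => x; rewrite /sinh_sum big_nil.
rewrite /cosh_sum big_cons -/(cosh_sum _ _) /=.
rewrite (_ : sinh_sum _ = fun z => i.1 * sinh (i.2 * z) + sinh_sum s z); last first.
  by apply/funext => x; rewrite /sinh_sum big_cons.
rewrite -mulrA; apply: is_deriveD_fun => //; apply: is_deriveZ_fun.
by apply: is_derive_scale; exact: is_derive_sinh.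
Qed.

Lemma is_derive_cosh_sum s z :
  is_derive z (1 : R) (cosh_sum s) (sinh_sum [seq (i.1 * i.2, i.2) | i <- s] z).
Proof.
elim: s => [|i s IH].
  rewrite /sinh_sum big_nil (_ : cosh_sum _ = cst 0); first exact: is_derive_cst.
  by apply/funext => x; rewrite /cosh_sum big_nil.
rewrite /sinh_sum big_cons -/(sinh_sum _ _) /=.
rewrite (_ : cosh_sum _ = fun z => i.1 * cosh (i.2 * z) + cosh_sum s z); last first.
  by apply/funext => x; rewrite /cosh_sum big_cons.
rewrite -mulrA; apply: is_deriveD_fun => //; apply: is_deriveZ_fun.
by apply: is_derive_scale; exact: is_derive_cosh.
Qed.

(* [d^2 - b^2] removes the terms of frequency [b]. *)
Lemma pos_then_neg_sinh_sum b s : 0 <= \sum_(i <- s) i.1 * i.2 ->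
  pos_then_neg (sinh_sum [seq (i.1 * (i.2 ^+ 2 - b ^+ 2), i.2) | i <- s]) ->
  pos_then_neg (sinh_sum s).
Proof.
move=> s0 sneg.
apply: (pos_then_neg_order2 (b := b) (@is_derive_sinh_sum s) (@is_derive_cosh_sum _)).
- by rewrite /sinh_sum big1// => i _; rewrite mulr0 sinh0 mulr0.
- rewrite {1}/sinh_sum big1 ?mulr0; last by move=> i _; rewrite mulr0 sinh0 mulr0.
  rewrite /cosh_sum big_map/=; under eq_bigr do rewrite mulr0 cosh0 mulr1.
  exact: s0.
- apply: pos_then_neg_eq_sign sneg => x _.
  suff -> : sinh_sum [seq (i.1 * (i.2 ^+ 2 - b ^+ 2), i.2) | i <- s] x =
    sinh_sum [seq (i.1 * i.2, i.2) | i <- [seq (i.1 * i.2, i.2) | i <- s]] x -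
    b ^+ 2 * sinh_sum s x by [].
  rewrite /sinh_sum !big_map mulr_sumr -sumrB; apply: eq_bigr => i _ /=; ring.
Qed.

Definition slope_terms c sg := [:: (sg * (1 - c) ^+ 2, 1 + 2 * c); (- sg * c ^+ 2, 3 - 2 * c);
  (- sg * (2 * c * (1 - 2 * c)), 1); (- sg * (1 - 2 * c ^+ 2), 1 - 2 * c)].

Lemma pos_then_neg_slope_terms c sg : 0 < c < 1 -> 0 <= sg * (1 - 2 * c) ->
  pos_then_neg (sinh_sum (slope_terms c sg)).
Proof.
move=> /andP[c0 c1] sgc.
(* This removes [sinh z]; the slope at [0] is identically zero. *)
apply: (pos_then_neg_sinh_sum (b := 1)).
  rewrite /slope_terms !big_cons big_nil/=.
  by rewrite le_eqVlt; apply/orP; left; apply/eqP; ring.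
(* This removes the only term with the sign of [sg]. *)
apply: (pos_then_neg_sinh_sum (b := 1 + 2 * c)).
  rewrite /slope_terms /= !big_cons big_nil/=.
  set l := (X in 0 <= X).
  have -> : l = 8 * c * (1 - c) ^+ 2 * (sg * (1 - 2 * c)) by rewrite /l; ring.
  by apply: mulr_ge0 => //; rewrite mulr_ge0 ?sqr_ge0// mulr_ge0// ltW.
apply: pos_then_neg_le0 => z z0.
rewrite /slope_terms /sinh_sum /= !big_cons big_nil /=.
set S3 := sinh ((3 - 2 * c) * z); set S1 := sinh ((1 - 2 * c) * z).
set l := (X in X <= 0).
have -> : l = - (32 * c ^+ 2 * (1 - c) *
  (sg * ((2 - c) * (1 - 2 * c) * S3 + (1 - 2 * c ^+ 2) * S1))) by rewrite /l; ring.
have S30 : 0 <= S3 by rewrite sinh_ge0// mulr_ge0// ?ltW//; lra.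
rewrite oppr_le0; apply: mulr_ge0.
  by rewrite mulr_ge0 ?subr_ge0 ?(ltW c1)// mulr_ge0 ?sqr_ge0.
have [jn|jp|j0] := ltgtP (1 - 2 * c) 0.
(* Here [S1] is negative, but [2 c - 1 <= 3 - 2 c] bounds it by [S3]. *)
- have S1' : - S3 <= S1 <= 0.
    by apply/andP; split; [rewrite -sinhN|rewrite -[leRHS]sinh0]; rewrite ler_sinh//; nra.
  have {}sgc : sg <= 0 by nra.
  apply: mulr_le0 => //; move: S1' => /andP[S1l S1u].
  have [c2|/ltW c2] := leP 0 (1 - 2 * c ^+ 2).
    have : (2 - c) * (1 - 2 * c) * S3 <= 0 by rewrite mulr_le0_ge0//; nra.
    have : (1 - 2 * c ^+ 2) * S1 <= 0 by rewrite mulr_ge0_le0.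
    by lra.
  (* The coefficient of [S3] becomes [(2 - c) (1 - 2 c) - (1 - 2 c ^ 2) = - (4 c - 1) (1 - c)],
     negative for [c > 1/2]. *)
  have : (1 - 2 * c ^+ 2) * S1 <= (1 - 2 * c ^+ 2) * - S3 by rewrite ler_wnM2l.
  have : 0 <= S3 * ((4 * c - 1) * (1 - c)) by apply: mulr_ge0 => //; apply: mulr_ge0; lra.
  by nra.
- have S1' : 0 <= S1 by rewrite sinh_ge0// mulr_ge0// ltW.
  have {}sgc : 0 <= sg by nra.
  apply: mulr_ge0 => //; rewrite addr_ge0// mulr_ge0//; nra.
- by rewrite /S1 j0 mul0r sinh0 !mulr0 mul0r addr0 mulr0.
Qed.

End Hyperbolic.

(** * The function [ln cosh] and the sign of [D] *)

Section LnCosh.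
Context {R : realType}.
Implicit Types (x y z a b c sg e : R).

Definition lncosh x : R := ln (cosh x).

Lemma lncosh0 : lncosh 0 = 0.
Proof. by rewrite /lncosh cosh0 ln1. Qed.

Lemma is_derive_lncosh x : is_derive x (1 : R) lncosh (sinh x / cosh x).
Proof.
rewrite mulrC; apply: (is_derive1_comp (f := @ln R) (g := cosh)).
  by apply: is_derive1_ln; exact: cosh_gt0.
exact: is_derive_cosh.
Qed.

Lemma lncoshE x : lncosh x = x - ln 2 + ln (1 + expR (- (2 * x))).
Proof.
have E : cosh x = expR x * (1 + expR (- (2 * x))) / 2.
  rewrite /cosh mulrDr mulr1 -expRD; congr ((_ + expR _) / _); ring.
have p1 : 0 < 1 + expR (- (2 * x)) by rewrite addr_gt0 ?expR_gt0.
rewrite /lncosh E ln_div ?posrE ?mulr_gt0 ?expR_gt0//.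
by rewrite lnM ?posrE ?expR_gt0// expRK; ring.
Qed.

Lemma lncosh_bounds x : 0 <= lncosh x - (x - ln 2) <= expR (- (2 * x)).
Proof.
rewrite lncoshE addrC addKr ln_ge0 ?lerDl ?expR_ge0//= le_ln1Dx//.
by rewrite (lt_trans _ (expR_gt0 _)).
Qed.

(** This is [(cosh z) ^ (2 c)]; the next two definitions are [N] and [M]. *)
Definition cosh_pow c z : R := expR (2 * (c * lncosh z)).
Definition slope_den c z : R := (1 - c) * sinh ((1 + c) * z) - c * sinh ((1 - c) * z).
Definition slope_num c z : R := cosh_pow c z * sinh ((1 - c) * z) - slope_den c z.

Lemma is_derive_cosh_pow c z :
  is_derive z (1 : R) (cosh_pow c) (cosh_pow c z * (2 * (c * (sinh z / cosh z)))).
Proof.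
apply: is_derive_expR_fun; apply: is_deriveZ_fun; apply: is_deriveZ_fun.
exact: is_derive_lncosh.
Qed.

Lemma is_derive_sinh_scale a z :
  is_derive z (1 : R) (fun z => sinh (a * z)) (a * cosh (a * z)).
Proof. by apply: is_derive_scale; exact: is_derive_sinh. Qed.

Definition slope_den_deriv c z : R := (1 - c) * ((1 + c) * cosh ((1 + c) * z)) -
  c * ((1 - c) * cosh ((1 - c) * z)).

Lemma is_derive_slope_den c z : is_derive z (1 : R) (slope_den c) (slope_den_deriv c z).
Proof.
apply: is_deriveD_fun; first by apply: is_deriveZ_fun; exact: is_derive_sinh_scale.
by apply: is_deriveN_fun; apply: is_deriveZ_fun; exact: is_derive_sinh_scale.
Qed.

Definition slope_num_deriv c z : R := cosh_pow c z * ((1 - c) * cosh ((1 - c) * z)) +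
  sinh ((1 - c) * z) * (cosh_pow c z * (2 * (c * (sinh z / cosh z)))) - slope_den_deriv c z.

Lemma is_derive_slope_num c z : is_derive z (1 : R) (slope_num c) (slope_num_deriv c z).
Proof.
apply: is_deriveD_fun; last by apply: is_deriveN_fun; exact: is_derive_slope_den.
by apply: is_deriveM_fun; [exact: is_derive_cosh_pow|exact: is_derive_sinh_scale].
Qed.

Lemma slope_den0 c : slope_den c 0 = 0.
Proof. by rewrite /slope_den !mulr0 sinh0 !mulr0 subrr. Qed.

Lemma slope_num0 c : slope_num c 0 = 0.
Proof. by rewrite /slope_num slope_den0 !mulr0 sinh0 mulr0 subrr. Qed.

Lemma slope_den_deriv0 c : slope_den_deriv c 0 = 1 - c.
Proof. by rewrite /slope_den_deriv !mulr0 cosh0; ring. Qed.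

Lemma slope_num_deriv0 c : slope_num_deriv c 0 = 0.
Proof.
by rewrite /slope_num_deriv slope_den_deriv0 /cosh_pow lncosh0 !mulr0 cosh0 sinh0 expR0; ring.
Qed.

(** [N] vanishes at [0], and [N' = (1 - c) (C1 + c (C1 - C2))] with [C1 >= C2 > 0]. *)
Lemma slope_den_gt0 c z : 0 < c < 1 -> 0 < z -> 0 < slope_den c z.
Proof.
move=> /andP[c0 c1] z0; rewrite -(slope_den0 c).
apply: (is_derive_gt0_lt (df := slope_den_deriv c)) => // [x _|x /andP[x0 _]].
  exact: is_derive_slope_den.
have h : cosh ((1 - c) * x) <= cosh ((1 + c) * x) by rewrite ler_cosh//; nra.
rewrite /slope_den_deriv.
set C1 := cosh ((1 + c) * x) in h *; set C2 := cosh ((1 - c) * x) in h *.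
have C10 : 0 < C1 by exact: cosh_gt0.
suff : 0 < (1 - c) * (C1 + c * (C1 - C2)) by nra.
by rewrite mulr_gt0 ?subr_gt0// ltr_pwDl// mulr_ge0 ?subr_ge0// ltW.
Qed.

(** The parenthesis is [(M / N)'] times [N ^ 2 cosh z / cosh_pow c z]; the summand [- N] of [M] only
    adds a constant to [M / N]. In [exp z] and [exp (c z)] the identity is rational. *)
Lemma quotient_derivative_identity c sg z :
  2 * sg * ((cosh z * ((1 - c) * cosh ((1 - c) * z)) +
     sinh ((1 - c) * z) * (2 * (c * sinh z))) * slope_den c z -
     cosh z * sinh ((1 - c) * z) * slope_den_deriv c z) = sinh_sum (slope_terms c sg) z.
Proof.
rewrite /sinh_sum /slope_terms !big_cons big_nil /= /slope_den /slope_den_deriv /sinh /cosh.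
set X := expR z; set Y := expR (c * z).
have X0 : X != 0 by rewrite gt_eqF ?expR_gt0.
have Y0 : Y != 0 by rewrite gt_eqF ?expR_gt0.
have e1p : expR ((1 + c) * z) = X * Y by rewrite mulrDl mul1r expRD.
have e1m : expR ((1 - c) * z) = X / Y by rewrite mulrBl mul1r expRD expRN.
have e2p : expR ((1 + 2 * c) * z) = X * Y ^+ 2.
  rewrite (_ : _ * z = z + (c * z + c * z)); last by ring.
  by rewrite !expRD expr2.
have e2m : expR ((1 - 2 * c) * z) = X / Y ^+ 2.
  rewrite (_ : _ * z = z - (c * z + c * z)); last by ring.
  by rewrite expRD expRN expRD expr2.
have e3 : expR ((3 - 2 * c) * z) = X ^+ 3 / Y ^+ 2.
  rewrite (_ : _ * z = (z + (z + z)) - (c * z + c * z)); last by ring.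
  by rewrite expRD expRN !expRD.
rewrite !expRN mul1r e1p e1m e2p e2m e3 -/X.
by field; rewrite X0 Y0.
Qed.

Lemma pos_then_neg_slope_num c sg : 0 < c < 1 -> 0 <= sg * (1 - 2 * c) ->
  pos_then_neg (fun z => sg * slope_num c z).
Proof.
move=> c01 sgc.
have Np z : 0 < z -> 0 < slope_den c z by exact: slope_den_gt0.
suff : pos_then_neg (fun z => sg * slope_num c z / slope_den c z).
  apply: pos_then_neg_eq_sign => x /Np Nx.
  by rewrite pmulr_lge0 ?invr_gt0// pmulr_lle0 ?invr_gt0.
(* The positive factor relating [sg (M / N)'] to the sum of [sinh] terms. *)
pose h z := cosh_pow c z / (2 * cosh z * slope_den c z ^+ 2).
apply: (@pos_then_neg_primitive _ _ (fun z => h z * sinh_sum (slope_terms c sg) z)).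
- move=> z /Np Nz; have Nz0 : slope_den c z != 0 by rewrite gt_eqF.
  have Cz0 : cosh z != 0 by rewrite gt_eqF ?cosh_gt0.
  have V := is_deriveV Nz0 (is_derive_slope_den c z).
  apply: (is_derive_eq (is_deriveM_fun (is_deriveZ_fun sg (is_derive_slope_num c z)) V)).
  rewrite -quotient_derivative_identity /h /GRing.scale/= /slope_num_deriv /slope_num.
  by field; rewrite Nz0 Cz0.
- move=> e z e0 z0.
  apply: (@quotient_ge_near0 _ (fun z => sg * slope_num c z) (slope_den c) (1 - c)) => //.
  + by have := is_deriveZ_fun sg (is_derive_slope_num c 0); rewrite slope_num_deriv0 mulr0.
  + by have := is_derive_slope_den c 0; rewrite slope_den_deriv0.
  + by rewrite slope_num0 mulr0.
  + exact: slope_den0.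
  + by rewrite subr_gt0; case/andP: c01.
- apply: pos_then_neg_mul; last exact: pos_then_neg_slope_terms.
  move=> x /Np Nx; rewrite divr_ge0 ?expR_ge0// mulr_ge0 ?sqr_ge0//.
  by rewrite mulr_ge0// ltW// cosh_gt0.
Qed.

(** The function [D]. *)
Definition lncosh_gap c z : R :=
  c ^+ 2 * lncosh z + (1 - c) * lncosh (c * lncosh z) - lncosh (c * z).

Lemma is_derive_lncosh_gap c z : is_derive z (1 : R) (lncosh_gap c)
  (c / (cosh z * cosh (c * z) * (cosh_pow c z + 1)) * slope_num c z).
Proof.
have d1 := is_derive_lncosh z.
have d2 := is_derive1_comp (f := lncosh) (g := fun z => c * lncosh z)
  (is_derive_lncosh (c * lncosh z)) (is_deriveZ_fun c d1).
have d3 := is_derive_scale (is_derive_lncosh (c * z)).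
apply: (is_derive_eq (is_deriveD_fun (is_deriveD_fun (is_deriveZ_fun (c ^+ 2) d1)
  (is_deriveZ_fun (1 - c) d2)) (is_deriveN_fun d3))).
(* [tanh w = (exp (2 w) - 1) / (exp (2 w) + 1)] at [w = c lncosh z]. *)
have -> : sinh (c * lncosh z) / cosh (c * lncosh z) = (cosh_pow c z - 1) / (cosh_pow c z + 1).
  rewrite /cosh_pow /sinh /cosh [2 * (c * _)]mulr_natl mulr2n expRD expRN.
  have E0 := expR_gt0 (c * lncosh z); set E := expR _ in E0 *.
  have En0 : E != 0 by rewrite gt_eqF.
  have E2 : E * E + 1 != 0 by rewrite gt_eqF// addr_gt0// mulr_gt0.
  by field; rewrite En0 -expr2 in E2 *; rewrite E2.
have W1 : cosh_pow c z + 1 != 0 by rewrite gt_eqF// addr_gt0// expR_gt0.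
have Cz0 : cosh z != 0 by rewrite gt_eqF ?cosh_gt0.
have Cc0 : cosh (c * z) != 0 by rewrite gt_eqF ?cosh_gt0.
have -> : slope_num c z = cosh_pow c z * (sinh z * cosh (c * z) - cosh z * sinh (c * z)) -
    ((1 - 2 * c) * (sinh z * cosh (c * z)) + cosh z * sinh (c * z)).
  rewrite /slope_num /slope_den (_ : (1 + c) * z = z + c * z); last by ring.
  rewrite (_ : (1 - c) * z = z - c * z); last by ring.
  by rewrite !sinhD sinhN coshN; ring.
by field; rewrite W1 Cz0 Cc0.
Qed.

Lemma lncosh_gap0 c : lncosh_gap c 0 = 0.
Proof. by rewrite /lncosh_gap !(mulr0, lncosh0); ring. Qed.

(** Writing [lncosh x = x - ln 2 + r x], the affine parts cancel in [D]. What is left is a convex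
    combination of two values of [r] minus a third, all in [[0, e]] far out. *)
Lemma lncosh_gap_small_at_infinity c e z : 0 < c < 1 -> 0 < e -> 0 < z ->
  exists2 y, z <= y & `|lncosh_gap c y| <= e.
Proof.
move=> /andP[c0 c1] e0 z0.
pose r x := lncosh x - (x - ln 2).
have r0 x : 0 <= r x by have /andP[] := lncosh_bounds x.
pose A := Num.max 0 (- ln e).
have A0 : 0 <= A by rewrite le_max lexx.
have rA x : A <= x -> r x <= e.
  move=> Ax; have /andP[_] := lncosh_bounds x; move/le_trans; apply.
  rewrite -[leRHS]lnK ?posrE// ler_expR.
  have : - ln e <= A by rewrite le_max lexx orbT.
  by lra.
have l20 : 0 <= ln (2 : R) by rewrite ln_ge0// ler1n.
have Ac0 : A <= A / c by rewrite ler_pdivlMr//; nra.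
have cAc : c * (A / c) = A by rewrite mulrC divfK// gt_eqF.
(* The term [A / c] absorbs the factor [c], and [ln 2] the loss in [lncosh y >= y - ln 2], so that
   [y], [c y] and [c lncosh y] all reach [A]. *)
pose y := z + A / c + ln 2.
have yA : A <= y by rewrite /y; lra.
have cyA : A <= c * y by rewrite -[leLHS]cAc ler_pM2l// /y; lra.
have cLA : A <= c * lncosh y.
  rewrite -[leLHS]cAc ler_pM2l//; have := r0 y; rewrite /r /y; lra.
exists y; first by rewrite /y; lra.
have -> : lncosh_gap c y = c * r y + (1 - c) * r (c * lncosh y) - r (c * y).
  by rewrite /lncosh_gap /r; ring.
have := rA _ yA; have := rA _ cyA; have := rA _ cLA.
have := r0 y; have := r0 (c * y); have := r0 (c * lncosh y).
move: (r y) (r (c * y)) (r (c * lncosh y)) => a b d d0 b0 a0 de be ae.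
by rewrite ler_norml; apply/andP; split; nra.
Qed.

Lemma lncosh_gap_sign c sg z : 0 < c < 1 -> 0 <= sg * (1 - 2 * c) -> 0 <= z ->
  0 <= sg * lncosh_gap c z.
Proof.
move=> c01 sgc; move: z.
apply: (@pos_then_neg_ge0 _ (fun z => sg * lncosh_gap c z)
  (fun z => c / (cosh z * cosh (c * z) * (cosh_pow c z + 1)) * (sg * slope_num c z))).
- move=> x; rewrite mulrCA; apply: is_deriveZ_fun; exact: is_derive_lncosh_gap.
- by rewrite lncosh_gap0 mulr0.
- apply: pos_then_neg_mul; last exact: pos_then_neg_slope_num.
  move=> x _; rewrite divr_ge0//; first by case/andP: c01 => /ltW.
  by rewrite !mulr_ge0// ?ltW// ?cosh_gt0// addr_gt0 ?expR_gt0.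
- move=> e z e0 z0.
  (* The added [1] keeps the divisor positive when [sg = 0]. *)
  have s0 : 0 < `|sg| + 1 by rewrite ltr_wpDl.
  have [y zy Dy] := lncosh_gap_small_at_infinity c01 (divr_gt0 e0 s0) z0.
  exists y => //; rewrite lerNl; apply: (le_trans (ler_norm _)).
  rewrite normrN normrM; apply: (le_trans (ler_wpM2l (normr_ge0 _) Dy)).
  rewrite mulrCA ler_piMr ?(ltW e0)// ler_pdivrMr// mul1r.
  by rewrite lerDl.
Qed.

End LnCosh.

(** * The inequality for [a ^ s + b ^ s = 1] *)

Section PowerInequality.
Context {R : realType}.
Implicit Types (a b s sg : R).

(* With [a = exp (m + h)] and [b = exp (m - h)], take [z = s h]; the constraint
   gives [m = - (ln 2 + lncosh z) / s]. *)
Lemma ln_sub_lncosh_gap s a b : 0 < s -> 0 < b -> 0 < a -> a `^ s + b `^ s = 1 ->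
  exists2 z, 0 <= z &
  (1 - s^-1) * ln (1 + 2 `^ (2 / s) * a * b) - ln (a + b) = lncosh_gap s^-1 z.
Proof.
wlog ab : a b / b <= a => [hwlog s0 b0 a0 abs|s0 b0 a0 abs].
  have [ba|/ltW ba] := leP b a; first exact: hwlog.
  move: abs; rewrite addrC => /(hwlog b a ba s0 a0 b0)[z z0 E].
  by exists z => //; rewrite -E mulrAC [b + a]addrC.
have sn0 : s != 0 by rewrite gt_eqF.
pose m := (ln a + ln b) / 2; pose h := (ln a - ln b) / 2; pose z := s * h.
have h0 : 0 <= h by rewrite divr_ge0// subr_ge0 ler_ln ?posrE.
have ea : a = expR m * expR h.
  by rewrite -expRD (_ : m + h = ln a) ?lnK ?posrE// /m /h; field.
have eb : b = expR m * expR (- h).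
  by rewrite -expRD (_ : m - h = ln b) ?lnK ?posrE// /m /h; field.
have sum_cosh (x y : R) : expR x * expR y + expR x * expR (- y) = expR x * (2 * cosh y).
  by rewrite /cosh; field.
have ms : s * m + (ln 2 + lncosh z) = 0.
  apply: expR_inj; rewrite expR0 expRD expRD /lncosh !lnK ?posrE ?cosh_gt0//.
  rewrite -sum_cosh -abs /powR !gt_eqF// ea eb -!expRD !expRK.
  by congr (expR _ + expR _); rewrite /z; ring.
have mE : m = - (s^-1 * ln 2 + s^-1 * lncosh z).
  by rewrite -mulrDr -mulrN (_ : - (_ + _) = s * m) ?mulKf//; move: ms; lra.
exists z; first by rewrite mulr_ge0// ltW.
have -> : ln (a + b) = m + ln 2 + lncosh (s^-1 * z).
  rewrite {1}ea {1}eb sum_cosh lnM ?posrE ?expR_gt0 ?(mulr_gt0 _ (cosh_gt0 _))//.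
  by rewrite expRK lnM ?posrE ?cosh_gt0// addrA /z mulKf.
(* As [a b = exp (2 m)], the constant [2 ^ (2 / s)] cancels the [ln 2] in [m]. *)
have -> : 2 `^ (2 / s) * a * b = expR (- (2 * (s^-1 * lncosh z))).
  rewrite /powR pnatr_eq0/= ea eb -!expRD; congr expR.
  by rewrite mE; field.
have -> : ln (1 + expR (- (2 * (s^-1 * lncosh z)))) =
    lncosh (s^-1 * lncosh z) - s^-1 * lncosh z + ln 2.
  by rewrite [lncosh (s^-1 * _)]lncoshE; ring.
by rewrite mE /lncosh_gap; ring.
Qed.

Lemma conj_exp_ineq s a b : 1 < s -> 0 <= a -> 0 <= b -> a `^ s + b `^ s = 1 ->
  (2 <= s -> (a + b) `^ conj_exp s <= 1 + 2 `^ (2 / s) * a * b) /\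
  (s <= 2 -> 1 + 2 `^ (2 / s) * a * b <= (a + b) `^ conj_exp s).
Proof.
move=> s1 a0 b0 abs.
have s0 : 0 < s by lra.
have sn0 : s != 0 by rewrite gt_eqF.
have root1 x : 0 <= x -> x `^ s = 1 -> x = 1.
  move=> x0 xs; apply: (powR_injective s0); rewrite ?nnegrE//.
  by rewrite xs powR1.
(* If [a] or [b] is zero, the other is [1] and both sides equal [1]; logarithms are taken only
   afterwards. *)
move: a0; rewrite le_eqVlt => /predU1P[a0|a0].
  move: abs; rewrite -a0 powR0// add0r => /(root1 _ b0) ->.
  by rewrite add0r powR1 mulr0 mul0r addr0.
move: b0; rewrite le_eqVlt => /predU1P[b0|b0].
  move: abs; rewrite -b0 powR0// addr0 => /(root1 _ (ltW a0)) ->.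
  by rewrite addr0 powR1 mulr0 addr0.
have [z z0 E] := ln_sub_lncosh_gap s0 b0 a0 abs.
have c01 : 0 < s^-1 < 1 by rewrite invr_gt0 s0 invf_lt1.
have T0 : 0 < 1 + 2 `^ (2 / s) * a * b by rewrite addr_gt0// !mulr_gt0 ?powR_gt0.
have S0 : 0 < (a + b) `^ conj_exp s by rewrite powR_gt0 ?addr_gt0.
have F : ln ((a + b) `^ conj_exp s) * (1 - s^-1) = ln (a + b).
  have s10 : s - 1 != 0 by rewrite subr_eq0 gt_eqF.
  by rewrite ln_powR /conj_exp; field; rewrite sn0 s10.
have c1 : 0 < 1 - s^-1 by rewrite subr_gt0; case/andP: c01.
(* Multiplying the logarithms by [1 - 1 / s], the inverse of the conjugate exponent, leaves [D],
   with [sg = 1] for [s >= 2] and [sg = -1] for [s <= 2]. *)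
split=> s2; rewrite -ler_ln ?posrE// -(ler_pM2r c1) F mulrC -subr_ge0.
- rewrite E -[lncosh_gap _ _]mul1r lncosh_gap_sign// mul1r subr_ge0.
  by rewrite ler_pdivrMr ?mul1r.
- rewrite -opprB E -mulN1r lncosh_gap_sign// mulN1r opprB subr_ge0.
  by rewrite ler_pdivlMr ?mul1r.
Qed.

End PowerInequality.

(** * The inequalities for [sn] and [cn] *)

Theorem theorem6p2 (R : realType) (p q r k x : R)
    (hp : 1 < p) (hq : 1 < q) (hr : 1 < r)
    (hk : 0 <= k < 1) (hx : 0 <= x <= Kpqr p q r k) :
  ((2 <= p ->
      (sn p q r x k `^ (q / p) + cn p q r x k) `^ conj_exp p
      <= 1 + 2 `^ (2 / p) * sn p q r x k `^ (q / p) * cn p q r x k) /\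
   (p <= 2 ->
      1 + 2 `^ (2 / p) * sn p q r x k `^ (q / p) * cn p q r x k
      <= (sn p q r x k `^ (q / p) + cn p q r x k) `^ conj_exp p)) /\
  ((2 <= q ->
      (sn p q r x k + cn p q r x k `^ (p / q)) `^ conj_exp q
      <= 1 + 2 `^ (2 / q) * sn p q r x k * cn p q r x k `^ (p / q)) /\
   (q <= 2 ->
      1 + 2 `^ (2 / q) * sn p q r x k * cn p q r x k `^ (p / q)
      <= (sn p q r x k + cn p q r x k `^ (p / q)) `^ conj_exp q)).
Proof.
have /andP[s0 s1] := sn_itv01 p q r x k.
have p0 : p != 0 by rewrite gt_eqF// (lt_trans ltr01).
have q0 : q != 0 by rewrite gt_eqF// (lt_trans ltr01).
have sq1 : 0 <= 1 - sn p q r x k `^ q.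
  rewrite subr_ge0 (_ : 1 = 1 `^ q); last by rewrite powR1.
  by rewrite ge0_ler_powR ?nnegrE// (le_trans ler01)// ltW.
(* In both parts the constraint reads [S ^ q + (1 - S ^ q) = 1], since [cn ^ p = 1 - S ^ q]. *)
split; apply: conj_exp_ineq => //; rewrite ?powR_ge0//.
- rewrite /cn -!powRrM divfK// mulVf// powRr1//; ring.
- rewrite /cn -!powRrM (_ : p^-1 * (p / q * q) = 1); last by field; rewrite p0 q0.
  rewrite powRr1//; ring.
Qed.
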